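(* Let $\mathfrak g$ be an indecomposable four-dimensional real Lie algebra with a three-dimensional commutative ideal $\mathfrak I$. All such Lie algebras, except $\mathfrak g^1_{4,2}$; $\mathfrak g^{\alpha,1}_{4,5}$ with $-1\le\alpha\le1$, $\alpha\ne0$; and $\mathfrak g^{\alpha,\alpha}_{4,5}$ with $-1<\alpha<1$, $\alpha\neq0$, have two-dimensional generating subspaces. A two-dimensional subspace $\mathfrak p\subset\mathfrak g$ generates $\mathfrak g$ if and only if it is not contained in $\mathfrak I$ and intersects by zero every ideal $\mathfrak J$ of $\mathfrak g$ with $\mathfrak J\subset\mathfrak I$, $\mathfrak J\ne\mathfrak I$. Moreover, if $\mathfrak p$ is generating, then for any basis $(e_1,e_2)$ of $\mathfrak p$ with $e_2\in\mathfrak p\cap\mathfrak I$, setting $e_3:=[e_1,e_2]$, $e_4:=[e_1,e_3]$, the vectors $(e_1,e_2,e_3,e_4)$ form a basis of $\mathfrak g$ with $C_{23}^4=0$, and $[e_2,e_3]=0$. Any two two-dimensional generating subspaces of $\mathfrak g$ are translated into each other by some automorphism of $\mathfrak g$.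
   Context: A subspace is generating if the smallest Lie subalgebra containing it is $\mathfrak g$. A Lie algebra is indecomposable if it is not a direct sum of two nonzero ideals. $C_{ij}^k$ are the structure constants: $[e_i,e_j]=\sum_kC_{ij}^ke_k$. Up to isomorphism, the Lie algebras in question, in a basis $E_1,\dots,E_4$ with $\mathfrak I=\mathrm{span}(E_1,E_2,E_3)$ and nonzero brackets indicated, are (Mubarakzyanov's classification): $\mathfrak g_{4,1}$: $[E_2,E_4]=E_1$, $[E_3,E_4]=E_2$; $\mathfrak g^{\alpha}_{4,2}$ ($\alpha\ne0$): $[E_1,E_4]=\alpha E_1$, $[E_2,E_4]=E_2$, $[E_3,E_4]=E_2+E_3$; $\mathfrak g_{4,3}$: $[E_1,E_4]=E_1$, $[E_3,E_4]=E_2$; $\mathfrak g_{4,4}$: $[E_1,E_4]=E_1$, $[E_2,E_4]=E_1+E_2$, $[E_3,E_4]=E_2+E_3$; $\mathfrak g^{\alpha,\beta}_{4,5}$ ($-1<\alpha\le\beta\le1$, $\alpha\beta\ne0$, or $\alpha=-1$, $0<\beta\le1$): $[E_1,E_4]=E_1$, $[E_2,E_4]=\beta E_2$, $[E_3,E_4]=\alpha E_3$; $\mathfrak g^{\alpha,\beta}_{4,6}$ ($\alpha>0$, $\beta\in\mathbb R$): $[E_1,E_4]=\alpha E_1$, $[E_2,E_4]=\beta E_2-E_3$, $[E_3,E_4]=E_2+\beta E_3$. *)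

(* Defs.v *)
From HB Require Import structures.
From mathcomp Require Import all_boot all_order all_algebra.
From mathcomp Require Import reals.
Set Implicit Arguments.
Unset Strict Implicit.
Unset Printing Implicit Defensive.
Import Order.TTheory GRing.Theory Num.Theory.
Local Open Scope ring_scope.

(* Finite-dimensional Lie algebras: being a [vectType] forces finite
   dimension. *)
HB.mixin Record Vector_isLieAlgebra (F : fieldType) V & Vector F V := {
  lie_bracket : V -> V -> V;
  lie_bracket_linearl : forall y : V, linear (fun x : V => lie_bracket x y);
  lie_bracket_linearr : forall x : V, linear (lie_bracket x);
  lie_bracketxx : forall x : V, lie_bracket x x = 0;
  lie_jacobi : forall x y z : V,
    lie_bracket x (lie_bracket y z) + lie_bracket y (lie_bracket z x)
      + lie_bracket z (lie_bracket x y) = 0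
}.

#[short(type="lieAlgType")]
HB.structure Definition LieAlgebra (F : fieldType) :=
  { V of Vector_isLieAlgebra F V & Vector F V }.

Notation "[ 'lie' x , y ]" := (lie_bracket x y)
  (at level 0, x at level 99, y at level 99, format "[ 'lie'  x ,  y ]")
  : ring_scope.

Section LieAlgebras.
Variables (F : fieldType) (g : lieAlgType F).
Implicit Types (U S p J K : {vspace g}) (f : 'End(g)).

Definition lie_subalgebra U : Prop :=
  forall x y : g, x \in U -> y \in U -> [lie x, y] \in U.

Definition lie_ideal J : Prop :=
  forall x y : g, y \in J -> [lie x, y] \in J.

Definition lie_commutative U : Prop :=
  forall x y : g, x \in U -> y \in U -> [lie x, y] = 0.

Definition smallest_subalgebra p S : Prop :=
  [/\ lie_subalgebra S, (p <= S)%VS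
    & forall U, lie_subalgebra U -> (p <= U)%VS -> (S <= U)%VS].

Definition generating p : Prop := smallest_subalgebra p fullv.

Definition decomposable : Prop :=
  exists J K, [/\ lie_ideal J, lie_ideal K, J != 0%VS, K != 0%VS
    & directv (J + K) /\ (J + K)%VS = fullv].

Definition indecomposable : Prop := ~ decomposable.

Definition lie_automorphism f : Prop :=
  lker f = 0%VS /\ forall x y : g, f [lie x, y] = [lie f x, f y].

(* [e_i, e_j] = \sum_k C_ij^k e_k; meaningful when e is a basis of g.
   Indices start at 0. *)
Definition structure_constant n (e : n.-tuple g) (i j k : 'I_n) : F :=
  coord e k [lie tnth e i, tnth e j].

End LieAlgebras.

(* Isomorphism with one of the model algebras of Mubarakzyanov's list is
   expressed as the existence of a basis with the listed brackets, the brackets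
   not listed (up to antisymmetry) being zero. *)
Definition iso_g42 (R : realType) (a : R) (g : lieAlgType R) : Prop :=
  a != 0 /\
  exists E1 E2 E3 E4 : g,
    [/\ basis_of fullv [:: E1; E2; E3; E4],
        [/\ [lie E1, E2] = 0, [lie E1, E3] = 0 & [lie E2, E3] = 0],
        [lie E1, E4] = a *: E1,
        [lie E2, E4] = E2
      & [lie E3, E4] = E2 + E3].

Definition g45_parameters (R : realType) (a b : R) : Prop :=
  [/\ -1 < a, a <= b, b <= 1 & a * b != 0] \/ [/\ a = -1, 0 < b & b <= 1].

Definition iso_g45 (R : realType) (a b : R) (g : lieAlgType R) : Prop :=
  g45_parameters a b /\
  exists E1 E2 E3 E4 : g,
    [/\ basis_of fullv [:: E1; E2; E3; E4],
        [/\ [lie E1, E2] = 0, [lie E1, E3] = 0 & [lie E2, E3] = 0],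
        [lie E1, E4] = E1,
        [lie E2, E4] = b *: E2
      & [lie E3, E4] = a *: E3].

Definition exceptional (R : realType) (g : lieAlgType R) : Prop :=
  [\/ iso_g42 1 g,
      exists a : R, [/\ -1 <= a, a <= 1, a != 0 & iso_g45 a 1 g]
    | exists a : R, [/\ -1 < a, a < 1, a != 0 & iso_g45 a a g]].

(* Main.v *)
(* Fix x outside I. Since I is commutative of codimension one, g is determined
   by A = ad x on I, the ideals of g inside I are the A-invariant subspaces, and
   a plane <x, v> with v in I generates g exactly when v lies in no proper
   invariant subspace, i.e. when v is a cyclic vector of A. All cyclic vectors
   satisfy the same cubic recurrence, whence the automorphisms. If A has no
   cyclic vector, then A = c + N with N of rank at most one: A is diagonalizable
   with a double eigenvalue c, or has Jordan blocks of sizes 2 and 1. Unless g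
   splits, the eigenvalues are nonzero and rescaling x yields one of the
   exceptional algebras. Conversely ad y is quadratic on I for each of those. *)
Require Import Defs.
From HB Require Import structures.
From mathcomp Require Import all_boot all_order all_algebra.
From mathcomp Require Import boolp reals ring zify.
Set Implicit Arguments.
Unset Strict Implicit.
Unset Printing Implicit Defensive.
Import Order.TTheory GRing.Theory Num.Theory.
Local Open Scope ring_scope.

(** * Membership in small spans, and equality of vectors by coordinates *)

Section VectorSpaces.
Variables (F : fieldType) (V : vectType F).
Implicit Types (u v w : V) (U : {vspace V}).

Lemma memv_span2P u v w :
  reflect (exists a b, w = a *: u + b *: v) (w \in <<[:: u; v]>>%VS).
Proof.
rewrite span_cons span_seq1; apply: (iffP memv_addP) => [[y /vlineP[a ->]]|].
  by move=> [z /vlineP[b ->]] ->; exists a, b.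
move=> [a [b ->]]; exists (a *: u); first by rewrite memvZ ?memv_line.
by exists (b *: v); rewrite ?memvZ ?memv_line.
Qed.

Lemma memv_span3P u v w y :
  reflect (exists a b c, y = a *: u + b *: v + c *: w)
          (y \in <<[:: u; v; w]>>%VS).
Proof.
rewrite span_cons; apply: (iffP memv_addP) => [[t /vlineP[a ->]]|].
  by move=> [z /memv_span2P[b [c ->]] ->]; exists a, b, c; rewrite addrA.
move=> [a [b [c ->]]]; exists (a *: u); first by rewrite memvZ ?memv_line.
exists (b *: v + c *: w); last by rewrite addrA.
by apply/memv_span2P; exists b, c.
Qed.

Lemma memvZE a v U : a != 0 -> (a *: v \in U) = (v \in U).
Proof.
move=> a0; apply/idP/idP => [|/memvZ]; last exact.
by move/(memvZ a^-1); rewrite scalerK.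
Qed.

Lemma vector_coordP u v :
  (forall i, coord (vbasis fullv) i u = coord (vbasis fullv) i v) -> u = v.
Proof.
move=> uv; rewrite (coord_vbasis (memvf u)) (coord_vbasis (memvf v)).
by apply: eq_bigr => i _; rewrite uv.
Qed.

End VectorSpaces.

(* [ring] and [field] do not handle modules, so vector identities are checked
   coordinatewise. *)
Ltac to_coords :=
  let i := fresh "i" in apply: vector_coordP => i;
  rewrite ?(scalerDr, scalerN, scalerA, scaler0);
  rewrite ?(linearD, linearN, linear0, linearZ_LR) /=.

(** * Bilinearity and antisymmetry of the bracket *)

Section LieBracket.
Variables (F : fieldType) (g : lieAlgType F).
Implicit Types (x y z : g).

Lemma lieDl x y z : [lie x + y, z] = [lie x, z] + [lie y, z].
Proof. by have := lie_bracket_linearl z 1 x y; rewrite !scale1r. Qed.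

Lemma lieDr x y z : [lie x, y + z] = [lie x, y] + [lie x, z].
Proof. by have := lie_bracket_linearr x 1 y z; rewrite !scale1r. Qed.

Lemma lie0l x : [lie 0, x] = 0.
Proof. by apply: (@addrI _ [lie 0, x]); rewrite -lieDl !addr0. Qed.

Lemma lie0r x : [lie x, 0] = 0.
Proof. by apply: (@addrI _ [lie x, 0]); rewrite -lieDr !addr0. Qed.

Lemma lieZl a x y : [lie a *: x, y] = a *: [lie x, y].
Proof. by have := lie_bracket_linearl y a x 0; rewrite lie0l !addr0. Qed.

Lemma lieZr a x y : [lie x, a *: y] = a *: [lie x, y].
Proof. by have := lie_bracket_linearr x a y 0; rewrite lie0r !addr0. Qed.

Lemma lieC x y : [lie x, y] = - [lie y, x].
Proof.
apply/eqP; rewrite -addr_eq0.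
by have := lie_bracketxx (x + y); rewrite lieDl !lieDr !lie_bracketxx add0r addr0 => ->.
Qed.

Definition lieE := (lieDl, lieDr, lieZl, lieZr, @lie_bracketxx F g).

End LieBracket.

(** * Commutative ideals of codimension one *)

Section CodimensionOne.
Variables (F : fieldType) (g : lieAlgType F) (I : {vspace g}).
Hypothesis I_codim : \dim {:g} = (\dim I).+1.
Hypothesis I_ideal : lie_ideal I.
Hypothesis I_comm : lie_commutative I.
Implicit Types (x y z v : g) (p J U : {vspace g}).

Lemma outside_addv x : x \notin I -> (<[x]> + I)%VS = fullv.
Proof.
move=> xI; have x0 : x != 0 by apply: contraNneq xI => ->; rewrite mem0v.
have cap0 : (<[x]> :&: I = 0)%VS.
  apply/eqP; rewrite -subv0; apply/subvP => _ /memv_capP[/vlineP[k ->] kI].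
  rewrite memv0; apply: contraNT xI; rewrite scaler_eq0 (negbTE x0) orbF.
  by move=> k0; rewrite memvZE in kI.
apply/eqP; rewrite eqEdim subvf I_codim /=.
by rewrite dimv_disjoint_sum // dim_vline x0.
Qed.

Lemma outside_decomp x y : x \notin I -> exists c, exists2 i, i \in I & y = c *: x + i.
Proof.
move/outside_addv => E; have : y \in fullv by rewrite memvf.
by rewrite -E => /memv_addP[_ /vlineP[c ->] [i iI ->]]; exists c, i.
Qed.

(** With [y = c *: x + i] and [z = d *: x + j], the bracket is [[lie x, c *: j - d *: i]]: the
    derived algebra is the image of [I] under [ad x]. *)
Lemma lie_derived_sub x U : x \notin I ->
  (forall i, i \in I -> [lie x, i] \in U) -> forall y z, [lie y, z] \in U.
Proof.
move=> xI AU y z; have [c [i iI ->]] := outside_decomp y xI.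
have [d [j jI ->]] := outside_decomp z xI.
rewrite !lieE (I_comm iI jI) (lieC i) !scaler0 add0r addr0.
by rewrite memvD ?memvZ ?memvN ?AU.
Qed.

(** On [I], every [ad y] is a multiple of [ad x], because [I] acts on itself by zero. *)
Lemma lie_outside_ideal x J : x \notin I -> (J <= I)%VS ->
  (forall v, v \in J -> [lie x, v] \in J) -> lie_ideal J.
Proof.
move=> xI /subvP JI AJ y v vJ; have [c [i iI ->]] := outside_decomp y xI.
by rewrite !lieE (I_comm iI (JI _ vJ)) addr0 memvZ ?AJ.
Qed.

Lemma basis_cons_outside X x : basis_of I X -> x \notin I -> basis_of fullv (x :: X).
Proof.
move=> bX xI; rewrite basisEfree free_cons (span_basis bX) xI (basis_free bX).
rewrite subvf I_codim /= ltnS -(span_basis bX); exact: dim_span.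
Qed.

(** * Which planes generate *)

Section Planes.
Variable p : {vspace g}.
Hypothesis p_dim : \dim p = 2%N.

Lemma plane_basis x v : x \in p -> x \notin I -> v \in (p :&: I)%VS -> v != 0 ->
  basis_of p [:: x; v].
Proof.
move=> xp xI /memv_capP[vp vI] v0.
rewrite basisEfree free_cons seq1_free v0 p_dim span_seq1 /= !andbT.
apply/andP; split.
  by apply: contra xI => /vlineP[k ->]; rewrite memvZ.
by apply/span_subvP => y; rewrite !inE => /orP[] /eqP ->.
Qed.

(** Here [p + I] is the whole algebra, so by the dimension formula [p] meets [I] in a line, spanned
    by [v]. *)
Lemma plane_basisP : ~~ (p <= I)%VS ->
  exists x v, [/\ x \notin I, v \in (p :&: I)%VS, v != 0 & basis_of p [:: x; v]].
Proof.
move=> /subvPn[x xp xI]; exists x, (vpick (p :&: I)%VS).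
have v0 : vpick (p :&: I)%VS != 0.
  rewrite vpick0 -dimv_eq0.
  have := dimv_sum_cap p I; suff -> : (p + I)%VS = fullv.
    by rewrite I_codim p_dim; lia.
  apply/eqP; rewrite eqEsubv subvf /= -(outside_addv xI) addvS //.
by split; rewrite ?memv_pick ?plane_basis ?memv_pick.
Qed.

Lemma generating_not_sub : generating p -> ~~ (p <= I)%VS.
Proof.
move=> [_ _ gen]; apply/negP => pI.
have := dimvS (gen I (fun x y _ => @I_ideal x y) pI).
by rewrite I_codim ltnn.
Qed.

(** A nonzero [v] in [p :&: J] would put [p], spanned by [x] and [v], inside the subalgebra [<[x]> +
    J], whose dimension is at most [\dim I]. *)
Lemma generating_capv_ideal J : generating p -> lie_ideal J -> (J <= I)%VS -> J != I ->
  (p :&: J)%VS = 0%VS.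
Proof.
move=> gp Jid JI JnI; have [_ _ gen] := gp.
apply/eqP; rewrite -vpick0; apply/negPn/negP => v0.
have /memv_capP[vp vJ] := memv_pick (p :&: J)%VS.
have /subvPn[x xp xI] := generating_not_sub gp.
set v := vpick _ in v0 vp vJ.
have bp : basis_of p [:: x; v].
  by rewrite plane_basis // memv_cap vp (subvP JI).
have Usub : lie_subalgebra (<[x]> + J).
  move=> _ _ /memv_addP[_ /vlineP[a ->] [i iJ ->]] /memv_addP[_ /vlineP[b ->] [j jJ ->]].
  rewrite !lieE (I_comm (subvP JI _ iJ) (subvP JI _ jJ)) (lieC i) !scaler0 add0r addr0.
  apply: subvP (addvSr _ _) _ _.
  by rewrite memvD ?memvZ ?memvN ?Jid.
have pU : (p <= <[x]> + J)%VS.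
  by rewrite -(span_basis bp) span_cons span_seq1 addvS // -memvE.
have := dimvS (gen _ Usub pU); rewrite I_codim; apply/negP; rewrite -ltnNge ltnS.
apply: leq_trans (dimv_add_leqif _ _) _; rewrite dim_vline.
have : (\dim J < \dim I)%N by rewrite (ltn_leqif (dimv_leqif_eq JI)).
by case: (x != 0) => //= /ltnW.
Qed.

(** If a subalgebra [U] contains [p], then [U :&: I] is stable under [ad x], hence an ideal. It
    contains the nonzero [v] of [p], so it must be [I]. *)
Lemma generating_of_capv_ideal : ~~ (p <= I)%VS ->
  (forall J, lie_ideal J -> (J <= I)%VS -> J != I -> (p :&: J)%VS = 0%VS) ->
  generating p.
Proof.
move=> pI capJ; have [x [v [xI /memv_capP[vp vI] v0 bp]]] := plane_basisP pI.
split=> [y z _ _||U Usub pU]; rewrite ?memvf ?subvf //.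
have xU : x \in U by rewrite (subvP pU) // (basis_mem bp) ?mem_head.
have UIid : lie_ideal (U :&: I).
  apply: (lie_outside_ideal xI (capvSr _ _)) => y /memv_capP[yU yI].
  by rewrite memv_cap Usub // I_ideal.
have [/capv_idPr IU|UnI] := eqVneq (U :&: I)%VS I.
  by rewrite -(outside_addv xI) subv_add IU -memvE xU.
have : v \in (p :&: (U :&: I))%VS by rewrite !memv_cap vp vI (subvP pU).
by rewrite capJ ?capvSr // memv0 (negbTE v0).
Qed.

Lemma generatingP : generating p <->
  ~ (p <= I)%VS /\
  forall J, lie_ideal J -> (J <= I)%VS -> J != I -> (p :&: J)%VS = 0%VS.
Proof.
split=> [gp|[/negP pI]]; last exact: generating_of_capv_ideal.
split; first exact/negP/generating_not_sub.
by move=> J; apply: generating_capv_ideal.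
Qed.

End Planes.
End CodimensionOne.

Section ThreeDimensionalIdeal.
Variables (F : fieldType) (g : lieAlgType F) (I : {vspace g}).
Hypothesis g_dim : \dim {:g} = 4%N.
Hypothesis I_dim : \dim I = 3%N.
Hypothesis I_ideal : lie_ideal I.
Hypothesis I_comm : lie_commutative I.
Implicit Types (x y z v : g) (p q J : {vspace g}).

Let I_codim : \dim {:g} = (\dim I).+1. Proof. by rewrite g_dim I_dim. Qed.

(** Any linear dependence would make [<[v]>] or the span of [v] and [[lie x, v]] invariant under
    [ad x], that is, a proper ideal in [I] meeting [p] in [v]. *)
Lemma generating_krylov_basis p x v : \dim p = 2%N -> generating p ->
    basis_of p [:: x; v] -> v \in I ->
  x \notin I /\ basis_of I [:: v; [lie x, v]; [lie x, [lie x, v]]].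
Proof.
move=> p_dim gp bp vI.
have xI : x \notin I.
  apply: contra (generating_not_sub I_codim I_ideal gp) => xI.
  by rewrite -(span_basis bp) span_cons span_seq1 subv_add -!memvE xI.
split=> //.
have vp : v \in p by rewrite (basis_mem bp) // !inE eqxx orbT.
have v0 : v != 0 by rewrite (basis_not0 bp) // !inE eqxx orbT.
set w := [lie x, v]; set z := [lie x, w].
have wI : w \in I by apply: I_ideal.
have zI : z \in I by apply: I_ideal.
have Jfull J : (J <= I)%VS -> v \in J ->
    (forall u, u \in J -> [lie x, u] \in J) -> J = I.
  move=> JI vJ AJ; apply: contrapT => /eqP JnI.
  have : v \in (p :&: J)%VS by rewrite memv_cap vp.
  have Jid := lie_outside_ideal I_codim I_comm xI JI AJ.
  by rewrite (generating_capv_ideal I_codim I_ideal I_comm p_dim gp Jid) // memv0 (negbTE v0).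
have wv : w \notin <[v]>%VS.
  apply/negP => /vlineP[c wE]; have : \dim <[v]> = 3%N.
    rewrite (Jfull <[v]>%VS) // ?memv_line -?memvE // => _ /vlineP[k ->].
    by rewrite lieZr -/w wE !memvZ ?memv_line.
  by rewrite dim_vline v0.
have zvw : z \notin <<[:: v; w]>>%VS.
  apply/negP => zE; have : \dim <<[:: v; w]>> = 3%N.
    rewrite (Jfull <<[:: v; w]>>%VS) //.
    - by apply/span_subvP => y; rewrite !inE => /orP[] /eqP ->.
    - by rewrite memv_span ?mem_head.
    move=> _ /memv_span2P[a [b ->]]; rewrite !lieE -/w -/z.
    by rewrite memvD ?memvZ ?zE // memv_span // !inE eqxx orbT.
  by have := dim_span [:: v; w] => /[swap] ->.
rewrite basisEfree I_dim /= andbT; apply/andP; split.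
  (* [free_cons] compares the head with the span of the tail, so the last Krylov vector is put
     first. *)
  rewrite (@perm_free _ _ _ [:: z; w; v]).
    rewrite !free_cons nil_free span_seq1 wv span_nil memv0 v0 !andbT.
    by rewrite (@eq_span _ _ _ [:: v; w]) // => y; rewrite !inE orbC.
  by rewrite -(perm_rev [:: v; w; z]).
by apply/span_subvP => y; rewrite !inE => /or3P[] /eqP ->.
Qed.

(* Replacing [x] by an element of [x + I] does not change [ad x] on [I], and all
   cyclic vectors of [ad x] on [I] satisfy the same cubic recurrence. *)
Lemma krylov_automorphism x y v w : x \notin I -> y - x \in I ->
    basis_of I [:: v; [lie x, v]; [lie x, [lie x, v]]] ->
    basis_of I [:: w; [lie y, w]; [lie y, [lie y, w]]] ->
  exists f : 'End(g), [/\ lie_automorphism f, f x = y & f v = w].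
Proof.
move=> xI yxI; set v2 := [lie x, v]; set v3 := [lie x, v2] => bv.
have yE u : u \in I -> [lie y, u] = [lie x, u].
  by move=> uI; rewrite -[y](subrK x) lieDl (I_comm yxI uI) add0r.
have yI : y \notin I by apply: contra xI => yI; rewrite -[x](subKr y) memvB.
move=> bw; have wI : w \in I by rewrite (basis_mem bw) ?mem_head.
rewrite (yE _ wI) in bw *; rewrite (yE _ (I_ideal x wI)) in bw *.
move: bw; set w2 := [lie x, w]; set w3 := [lie x, w2] => bw.
have fb := basis_free (basis_cons_outside I_codim bv xI).
have [f0 f0P] := linear_of_free [:: x; v; v2; v3] [:: y; w; w2; w3].
pose f : 'End(g) := linfun f0.
have [fx fv fv2 fv3] : [/\ f x = y, f v = w, f v2 = w2 & f v3 = w3].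
  by rewrite !lfunE; case: (f0P fb erefl) => -> -> -> ->.
exists f; split=> //.
have vI : v \in I by rewrite (basis_mem bv) ?mem_head.
have : [lie x, v3] \in I by rewrite !I_ideal.
rewrite -{1}(span_basis bv) => /memv_span3P[r [s [t v4E]]].
(* [w] is a polynomial in [ad x] applied to [v], and polynomials in [ad x] commute, so the relation
   [v4E] carries over from [v] to [w]. *)
have w4E : [lie x, w3] = r *: w + s *: w2 + t *: w3.
  move: wI; rewrite -{1}(span_basis bv) => /memv_span3P[a [b [c wE]]].
  have w2E : w2 = a *: v2 + b *: v3 + c *: [lie x, v3] by rewrite /w2 wE !lieE.
  have w3E : w3 = a *: v3 + b *: [lie x, v3] + c *: [lie x, [lie x, v3]].
    by rewrite /w3 w2E !lieE.
  rewrite {1}w3E w3E w2E wE !(lieE, v4E) -/v2 -/v3 ?(lieE, v4E).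
  by to_coords; ring.
have fA i : i \in I -> f [lie x, i] = [lie x, f i].
  rewrite -{1}(span_basis bv) => /memv_span3P[a [b [c ->]]].
  rewrite !lieE -/v2 -/v3 v4E !linearD !linearZ /= fv fv2 fv3 !lieE.
  by rewrite -/w2 -/w3 w4E !scalerDr.
have fI i : i \in I -> f i \in I.
  rewrite -{1}(span_basis bv) => /memv_span3P[a [b [c ->]]].
  rewrite !linearD !linearZ /= fv fv2 fv3.
  by rewrite !memvD ?memvZ ?I_ideal.
split.
  (* The image contains the basis [y, w, w2, w3]; injectivity then follows by rank-nullity. *)
  have fimg : limg f = fullv.
    rewrite -{1}(span_basis (basis_cons_outside I_codim bv xI)) limg_span /= fx fv fv2 fv3.
    by rewrite (span_basis (basis_cons_outside I_codim bw yI)).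
  apply/eqP; rewrite -dimv_eq0; have := limg_ker_dim f fullv.
  rewrite fimg capfv; lia.
move=> a b; have [c [i iI ->]] := outside_decomp I_codim a xI.
have [d [j jI ->]] := outside_decomp I_codim b xI.
rewrite !lieE (I_comm iI jI) (lieC i) !scaler0 add0r addr0.
rewrite !linearD !linearZ /= linearN /= fx !fA // !lieE (I_comm (fI _ iI) (fI _ jI)).
by rewrite (lieC (f i)) !yE ?fI // !scaler0 add0r addr0.
Qed.

(** Rescaling the basis vector of [p] outside [I] makes it congruent to [x] modulo [I]. Different
    planes can then be compared through one and the same operator [ad x] on [I]. *)
Lemma generating_adapted_basis p x : \dim p = 2%N -> generating p -> x \notin I ->
  exists y v, [/\ y - x \in I, basis_of p [:: y; v] & v \in I].
Proof.
move=> p_dim gp xI; have pI := generating_not_sub I_codim I_ideal gp.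
have [y [v [yI vpI v0 bp]]] := plane_basisP I_codim p_dim pI.
have [c [i iI xE]] := outside_decomp I_codim x yI.
have c0 : c != 0.
  by apply: contraNneq xI => c0; rewrite xE c0 scale0r add0r.
exists (c *: y), v; split.
- by rewrite xE opprD addrA subrr add0r memvN.
- apply: (plane_basis p_dim) (vpI) v0; last by rewrite memvZE.
  by rewrite memvZ // (basis_mem bp) ?mem_head.
by case/memv_capP: vpI.
Qed.

Lemma generating_conjugate p q : \dim p = 2%N -> \dim q = 2%N ->
    generating p -> generating q ->
  exists2 f : 'End(g), lie_automorphism f & (f @: p)%VS = q.
Proof.
move=> p_dim q_dim gp gq; have pI := generating_not_sub I_codim I_ideal gp.
have [x [v [xI vpI _ bp]]] := plane_basisP I_codim p_dim pI.
have vI : v \in I by case/memv_capP: vpI.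
have [y [w [yxI bq wI]]] := generating_adapted_basis q_dim gq xI.
have [_ bv] := generating_krylov_basis p_dim gp bp vI.
have [_ bw] := generating_krylov_basis q_dim gq bq wI.
have [f [fP fx fv]] := krylov_automorphism xI yxI bv bw.
exists f => //.
by rewrite -(span_basis bp) limg_span /= fx fv (span_basis bq).
Qed.


(** * Operators on [I] without cyclic vectors *)

Lemma triple_basis v1 v2 v3 : v1 \in I -> v2 \in I -> v3 \in I ->
  v3 != 0 -> v2 \notin <[v3]>%VS -> v1 \notin <<[:: v2; v3]>>%VS ->
  basis_of I [:: v1; v2; v3].
Proof.
move=> v1I v2I v3I v30 v23 v123.
rewrite basisEfree !free_cons nil_free span_seq1 span_nil memv0 v30 v23 v123 I_dim /=.
by rewrite andbT; apply/span_subvP => y; rewrite !inE => /or3P[] /eqP ->.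
Qed.

Lemma triple_basis_change u1 u2 u3 v1 v2 v3 : basis_of I [:: u1; u2; u3] ->
    {subset [:: u1; u2; u3] <= <<[:: v1; v2; v3]>>%VS} ->
  basis_of I [:: v1; v2; v3].
Proof.
move=> bu uv; rewrite basisEdim I_dim andbT -(span_basis bu).
exact/span_subvP.
Qed.

(** The hypothesis excludes cyclic vectors of [ad x]. The last alternative separates a Jordan block
    of size 2 from the diagonalizable case, where [d = c] is allowed. *)
Lemma noncyclic_normal_form x :
    (forall v, v \in I -> exists J, [/\ lie_ideal J, (J <= I)%VS, J != I & v \in J]) ->
  exists b1 b2 b3 c, [/\ basis_of I [:: b1; b2; b3],
    [lie x, b1] = c *: b1, [lie x, b2] = c *: b2
    & [lie x, b3] = c *: b3 + b2 \/ exists d, [lie x, b3] = d *: b3].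
Proof.
move=> noncyc.
have [[u [uI Au]]|scal] := EM (exists u, u \in I /\ [lie x, u] \notin <[u]>%VS); last first.
  have {}scal v : v \in I -> exists c, [lie x, v] = c *: v.
    move=> vI; apply/vlineP; apply: contrapT => /negP nv.
    by apply: scal; exists v.
  have [[|b1 [|b2 [|b3 []]]] sb bI] // : exists2 b : seq g, size b = 3%N & basis_of I b.
    by exists (vbasis I); rewrite ?size_tuple ?I_dim ?vbasisP.
  have b1I : b1 \in I by rewrite (basis_mem bI) ?mem_head.
  have b2I : b2 \in I by rewrite (basis_mem bI) // !inE eqxx orbT.
  have b3I : b3 \in I by rewrite (basis_mem bI) // !inE eqxx !orbT.
  have [c1 A1] := scal _ b1I; have [c2 A2] := scal _ b2I; have [c3 A3] := scal _ b3I.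
  (* Since [b1 + b2] is an eigenvector too, [b1] and [b2] share their eigenvalue. That of [b3] may
     stay arbitrary, as [d] is. *)
  have [c A12] := scal _ (memvD b1I b2I).
  have c12 : c1 = c2.
    have A12' : (c1 - c) *: b1 = (c - c2) *: b2.
      have <- : [lie x, b1 + b2] - c *: b1 - c2 *: b2 = (c1 - c) *: b1.
        by rewrite lieDr A1 A2; to_coords; ring.
      by rewrite A12; to_coords; ring.
    have := basis_free bI; rewrite !free_cons => /and3P[b1n b2n _].
    have b20 : b2 != 0 by apply: contraNneq b2n => ->; rewrite mem0v.
    have c1c : c1 = c.
      apply: contraNeq b1n; rewrite -subr_eq0 => c1c.
      by rewrite -(memvZE _ _ c1c) A12' memvZ // memv_span ?mem_head.
    move: A12'; rewrite c1c subrr scale0r => /esym/eqP.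
    by rewrite scaler_eq0 (negbTE b20) orbF subr_eq0 => /eqP.
  exists b1, b2, b3, c1; split=> //; first by rewrite A2 c12.
  by right; exists c3.
(* Some u is not an eigenvector. Let c be the scalar by which ad x acts on
   I / <u, [x, u]> and n = (ad x - c) u; testing the noncyclicity of suitable
   vectors w + k u shows that ad x - c maps I into <n>. *)
set Pu := <<[:: u; [lie x, u]]>>%VS.
have AuI : [lie x, u] \in I by apply: I_ideal.
have u0 : u != 0 by apply: contraNneq Au => ->; rewrite lie0r mem0v.
have PI : (Pu <= I)%VS.
  by apply/span_subvP => y; rewrite !inE => /orP[] /eqP ->.
have dimP : (\dim Pu <= 2)%N := dim_span _.
have /subvPn[w wI wP] : ~~ (I <= Pu)%VS.
  by apply/negP => /dimvS; rewrite I_dim => /leq_trans/(_ dimP).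
have bw : basis_of I [:: w; [lie x, u]; u].
  apply: triple_basis => //; rewrite (@eq_span _ _ _ [:: u; [lie x, u]]) // => y.
  by rewrite !inE orbC.
have : [lie x, w] \in I by apply: I_ideal.
rewrite -{1}(span_basis bw) => /memv_span3P[c [al [be0 Aw]]].
(* The coefficient of [u] once [[lie x, u]] is replaced by [c *: u + n]. *)
pose be := be0 + al * c.
have [n nE] : exists n, n = [lie x, u] - c *: u by exists ([lie x, u] - c *: u).
have nI : n \in I by rewrite nE memvB ?memvZ.
have Axu : [lie x, u] = c *: u + n by rewrite nE addrC subrK.
have {}Aw : [lie x, w] = c *: w + al *: n + be *: u.
  by rewrite Aw Axu /be; to_coords; ring.
have bn : basis_of I [:: w; n; u].
  apply: (triple_basis_change bw) => y; rewrite !inE => /or3P[] /eqP ->.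
  - by rewrite memv_span ?mem_head.
  - by apply/memv_span3P; exists 0, 1, c; rewrite Axu; to_coords; ring.
  - by rewrite memv_span // !inE eqxx !orbT.
have ideal_full J : (J <= I)%VS -> w \in J -> n \in J -> u \in J -> J = I.
  move=> JI wJ nJ uJ; apply/eqP; rewrite eqEsubv JI -(span_basis bn).
  by apply/span_subvP => y; rewrite !inE => /or3P[] /eqP ->.
have [J0 [J0id J0I J0n uJ0]] := noncyc u uI.
have nJ0 : n \in J0 by rewrite nE memvB ?memvZ ?J0id.
have : [lie x, n] \in I by apply: I_ideal.
rewrite -{1}(span_basis bn) => /memv_span3P[h [e' [f An]]].
(* A proper ideal [J0] containing [u] also contains [n] and [[lie x, n]]; with [h != 0] it would
   contain [w] and be all of [I]. *)
have h0 : h = 0.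
  apply: contrapT => /eqP h0; case/eqP: J0n; apply: ideal_full => //.
  rewrite -(memvZE _ _ h0); have -> : h *: w = [lie x, n] - (e' *: n + f *: u).
    by rewrite An; to_coords; ring.
  by rewrite memvB ?J0id ?memvD ?memvZ.
pose e := e' - c.
have {h0}An : [lie x, n] = (c + e) *: n + f *: u.
  by rewrite An h0 /e; to_coords; ring.
(* The test vector [w - al *: u] is chosen so that [ad x - c] sends it to [be *: u]. *)
have be_0 : be = 0.
  apply: contrapT => /eqP be_n0.
  have [J [Jid JI Jn vJ]] : exists J,
      [/\ lie_ideal J, (J <= I)%VS, J != I & w - al *: u \in J].
    by apply: noncyc; rewrite memvB ?memvZ.
  have uJ : u \in J.
    rewrite -(memvZE _ _ be_n0).
    have -> : be *: u = [lie x, w - al *: u] - c *: (w - al *: u).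
      by rewrite -scaleNr !lieE Aw Axu; to_coords; ring.
    by rewrite memvB ?memvZ ?Jid.
  case/eqP: Jn; apply: ideal_full => //.
    by rewrite -[w](subrK (al *: u)) memvD ?memvZ.
  by rewrite nE memvB ?memvZ ?Jid.
rewrite {}be_0 scale0r addr0 in Aw.
(* Now that [be = 0], [ad x - c] sends the test vector [w + (1 - al) *: u] to [n], and [n] to
   [e *: n + f *: u]. *)
have f0 : f = 0.
  apply: contrapT => /eqP f_n0.
  have [J [Jid JI Jn vJ]] : exists J,
      [/\ lie_ideal J, (J <= I)%VS, J != I & w + (1 - al) *: u \in J].
    by apply: noncyc; rewrite memvD ?memvZ.
  have nJ : n \in J.
    have -> : n = [lie x, w + (1 - al) *: u] - c *: (w + (1 - al) *: u).
      by rewrite !lieE Aw Axu; to_coords; ring.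
    by rewrite memvB ?memvZ ?Jid.
  have uJ : u \in J.
    rewrite -(memvZE _ _ f_n0); have -> : f *: u = [lie x, n] - (c + e) *: n.
      by rewrite An; to_coords; ring.
    by rewrite memvB ?memvZ ?Jid.
  case/eqP: Jn; apply: ideal_full => //.
  by rewrite -[w](addrK ((1 - al) *: u)) memvB ?memvZ.
rewrite {}f0 scale0r addr0 in An.
have Aw' : [lie x, w - al *: u] = c *: (w - al *: u).
  by rewrite -scaleNr !lieE Aw Axu; to_coords; ring.
(* At this point [ad x - c] kills [w - al *: u], sends [u] to [n] and [n] to [e *: n]. For [e = 0]
   this is a Jordan chain; otherwise [n - e *: u] is a second vector of the kernel and [n] has
   eigenvalue [c + e]. *)
have [e0|e_n0] := eqVneq e 0.
  exists (w - al *: u), n, u, c; split=> //.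
  - apply: (triple_basis_change bn) => y; rewrite !inE => /or3P[] /eqP ->.
    + by apply/memv_span3P; exists 1, 0, al; to_coords; ring.
    + by rewrite memv_span // !inE eqxx orbT.
    + by rewrite memv_span // !inE eqxx !orbT.
  - by rewrite An e0 addr0.
  - by left; rewrite Axu.
exists (w - al *: u), (n - e *: u), n, c; split=> //.
- apply: (triple_basis_change bn) => y; rewrite !inE => /or3P[] /eqP ->.
  + by apply/memv_span3P; exists 1, (- al / e), (al / e); to_coords; field.
  + by rewrite memv_span // !inE eqxx !orbT.
  + by apply/memv_span3P; exists 0, (- e^-1), e^-1; to_coords; field.
- by rewrite -scaleNr !lieE An Axu; to_coords; ring.
- by right; exists (c + e).
Qed.

(** The vector [b1] is central, and the span of [x, b2, b3] is an ideal because it contains the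
    derived algebra. *)
Lemma direct_summand_decomposable x b1 b2 b3 : x \notin I ->
    basis_of I [:: b1; b2; b3] -> [lie x, b1] = 0 ->
    [lie x, b2] \in <<[:: b2; b3]>>%VS -> [lie x, b3] \in <<[:: b2; b3]>>%VS ->
  decomposable g.
Proof.
move=> xI bI A1 A2 A3.
have AI i : i \in I -> [lie x, i] \in <<[:: b2; b3]>>%VS.
  rewrite -{1}(span_basis bI) => /memv_span3P[a [b [c ->]]].
  by rewrite !lieE A1 scaler0 add0r memvD ?memvZ.
have bg : basis_of fullv [:: b1; x; b2; b3].
  rewrite (@perm_basis _ _ _ [:: x; b1; b2; b3]) ?(basis_cons_outside I_codim bI xI) //.
  exact: (permEl (perm_catCA [:: b1] [:: x] [:: b2; b3])).
have /= := basis_free bg.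
rewrite -[[:: b1; x; b2; b3]]/([:: b1] ++ [:: x; b2; b3]) cat_free seq1_free.
move=> /and3P[b10 fK direct].
exists <<[:: b1]>>%VS, <<[:: x; b2; b3]>>%VS; split.
- apply: (lie_outside_ideal I_codim I_comm xI).
    by rewrite span_seq1 -memvE (basis_mem bI) ?mem_head.
  move=> v; rewrite span_seq1 => /vlineP[k ->].
  by rewrite lieZr A1 scaler0 mem0v.
- move=> y z _; rewrite span_cons (subvP (addvSr _ _)) //.
  exact: (lie_derived_sub I_codim I_comm xI).
- by rewrite -dimv_eq0 span_seq1 dim_vline b10.
- by rewrite -dimv_eq0 (eqP fK).
by split=> //; rewrite -span_cat (span_basis bg).
Qed.

(** A generating plane would yield a Krylov basis for [ad y] on [I], against the quadratic
    relation. *)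
Lemma quadratic_not_generating y r s : y \notin I ->
    (forall v, v \in I -> [lie y, [lie y, v]] = r *: v + s *: [lie y, v]) ->
  ~ exists p, \dim p = 2%N /\ generating p.
Proof.
move=> yI quad [p [p_dim gp]].
have [x [v [xyI bp vI]]] := generating_adapted_basis p_dim gp yI.
have [_ /basis_free] := generating_krylov_basis p_dim gp bp vI.
have xE u : u \in I -> [lie x, u] = [lie y, u].
  by move=> uI; rewrite -[x](subrK y) lieDl (I_comm xyI uI) add0r.
rewrite (xE _ vI) (xE _ (I_ideal y vI)) quad //.
rewrite (@perm_free _ _ _ [:: r *: v + s *: [lie y, v]; v; [lie y, v]]).
  by rewrite free_cons => /andP[/memv_span2P[]]; exists r, s.
exact: (permEl (perm_catC [:: v; [lie y, v]] [:: _])).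
Qed.

(** Contrapositively, if [v] lies in no proper ideal inside [I], then [v] and any [x] outside [I]
    span a generating plane. *)
Lemma noncyclic_of_not_generating : ~ (exists p, \dim p = 2%N /\ generating p) ->
  forall v, v \in I -> exists J, [/\ lie_ideal J, (J <= I)%VS, J != I & v \in J].
Proof.
move=> ngen v vI; apply: contrapT => nJ; apply: ngen.
have Jfull J : lie_ideal J -> (J <= I)%VS -> v \in J -> J = I.
  by move=> Jid JI vJ; apply: contrapT => /eqP JnI; apply: nJ; exists J.
have v0 : v != 0.
  apply/eqP => v0; have : \dim (0%VS : {vspace g}) = 3%N.
    rewrite (Jfull 0%VS) ?sub0v ?v0 ?mem0v // => x y; rewrite memv0 => /eqP ->.
    by rewrite lie0r mem0v.
  by rewrite dimv0.
have /subvPn[x _ xI] : ~~ (fullv <= I)%VS.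
  by apply/negP => /dimvS; rewrite g_dim I_dim.
have fp : free [:: x; v].
  rewrite free_cons seq1_free span_seq1 v0 andbT.
  by apply: contra xI => /vlineP[k ->]; rewrite memvZ.
have p_dim : \dim <<[:: x; v]>> = 2%N by apply/eqP.
have xp : x \in <<[:: x; v]>>%VS by rewrite memv_span ?mem_head.
exists <<[:: x; v]>>%VS; split=> //.
apply/(generatingP I_codim I_ideal I_comm p_dim); split.
  by move=> /subvP/(_ x xp); apply/negP.
move=> J Jid JI JnI; apply/eqP; rewrite -subv0; apply/subvP => y.
move=> /memv_capP[/memv_span2P[a [b ->]] yJ]; rewrite memv0.
have a0 : a = 0.
  apply: contrapT => /eqP a0; case/negP: xI; rewrite -(memvZE _ _ a0).
  by rewrite -[a *: x](addrK (b *: v)) memvB ?(subvP JI _ yJ) ?memvZ.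
rewrite a0 scale0r add0r in yJ *; rewrite scaler_eq0 (negbTE v0) orbF.
by apply: contraNT JnI => b0; rewrite (Jfull J) // -(memvZE _ _ b0).
Qed.

End ThreeDimensionalIdeal.

(** * Identification with the exceptional algebras over the reals *)

Section RealClassification.
Variables (R : realType) (g : lieAlgType R) (I : {vspace g}).
Hypothesis g_dim : \dim {:g} = 4%N.
Hypothesis g_indec : indecomposable g.
Hypothesis I_dim : \dim I = 3%N.
Hypothesis I_ideal : lie_ideal I.
Hypothesis I_comm : lie_commutative I.
Implicit Types (x y z v : g) (p q J : {vspace g}).

Let I_codim : \dim {:g} = (\dim I).+1. Proof. by rewrite g_dim I_dim. Qed.

Lemma basis_model x c b1 b2 b3 : x \notin I -> c != 0 ->
  basis_of I [:: b1; b2; b3] -> basis_of fullv [:: b1; b2; b3; c *: x].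
Proof.
move=> xI c0 bI; have cxI : c *: x \notin I by rewrite memvZE.
rewrite (@perm_basis _ _ _ [:: c *: x; b1; b2; b3]) ?(basis_cons_outside I_codim bI cxI) //.
exact: (permEl (perm_catC [:: b1; b2; b3] [:: c *: x])).
Qed.

Lemma model_comm b1 b2 b3 : basis_of I [:: b1; b2; b3] ->
  [/\ [lie b1, b2] = 0, [lie b1, b3] = 0 & [lie b2, b3] = 0].
Proof.
by move=> bI; split; apply: I_comm; rewrite (basis_mem bI) // !inE eqxx ?orbT.
Qed.

(** A zero eigenvalue would split off a line. Dividing by the eigenvalue of larger absolute value
    brings the remaining parameter into [[-1, 1]]: the double eigenvalue [c] becomes 1 if
    [|d| <= |c|], and the simple one [d] otherwise. *)
Lemma diagonal_exceptional x b1 b2 b3 c d : x \notin I ->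
    basis_of I [:: b1; b2; b3] ->
    [lie x, b1] = c *: b1 -> [lie x, b2] = c *: b2 -> [lie x, b3] = d *: b3 ->
  exceptional g.
Proof.
move=> xI bI A1 A2 A3.
have in2 b b' k : k *: b \in <<[:: b; b']>>%VS by rewrite memvZ ?memv_span ?mem_head.
have in2' b b' k : k *: b' \in <<[:: b; b']>>%VS.
  by rewrite memvZ ?memv_span // !inE eqxx orbT.
have bI' : basis_of I [:: b3; b1; b2].
  rewrite (@perm_basis _ _ _ [:: b1; b2; b3]) //.
  exact: (permEl (perm_catC [:: b3] [:: b1; b2])).
have c0 : c != 0.
  apply/eqP => c0; apply: g_indec.
  by apply: (direct_summand_decomposable g_dim I_dim I_comm xI bI);
    rewrite ?A1 ?A2 ?A3 ?c0 ?scale0r ?mem0v ?in2'.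
have d0 : d != 0.
  apply/eqP => d0; apply: g_indec.
  by apply: (direct_summand_decomposable g_dim I_dim I_comm xI bI');
    rewrite ?A1 ?A2 ?A3 ?d0 ?scale0r ?in2 ?in2'.
have [dc|cd] := lerP `|d| `|c|.
  have : `|d / c| <= 1 by rewrite normf_div ler_pdivrMr ?normr_gt0 ?mul1r.
  rewrite ler_norml => /andP[ge1 le1].
  have a0 : d / c != 0 by rewrite mulf_neq0 ?invr_neq0.
  apply: Or32; exists (d / c); split=> //; split.
    (* The value -1 is covered only by the second clause of [g45_parameters]. *)
    have [a1|an1] := eqVneq (d / c) (-1); [right|left]; first by rewrite ltr01 lexx.
    by rewrite lt_neqAle eq_sym an1 ge1 le1 mulr1 lexx.
  (* The sign is there because the models list [[lie Ei, E4]], not [[lie E4, Ei]]. *)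
  exists b1, b2, b3, (- c^-1 *: x).
  split; rewrite ?basis_model ?oppr_eq0 ?invr_eq0 //; first exact: model_comm.
  - by rewrite lieC lieZl A1 scalerA mulNr mulVf // scaleN1r opprK.
  - by rewrite lieC lieZl A2 scalerA mulNr mulVf // scaleN1r opprK scale1r.
  - by rewrite lieC lieZl A3 scalerA mulNr scaleNr opprK mulrC.
have : `|c / d| < 1 by rewrite normf_div ltr_pdivrMr ?normr_gt0 ?mul1r.
rewrite ltr_norml => /andP[gt1 lt1].
have a0 : c / d != 0 by rewrite mulf_neq0 ?invr_neq0.
apply: Or33; exists (c / d); split=> //; split.
  by left; rewrite gt1 lexx (ltW lt1) mulf_neq0.
exists b3, b1, b2, (- d^-1 *: x).
split; rewrite ?basis_model ?oppr_eq0 ?invr_eq0 //; first exact: model_comm.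
- by rewrite lieC lieZl A3 scalerA mulNr mulVf // scaleN1r opprK.
- by rewrite lieC lieZl A1 scalerA mulNr scaleNr opprK mulrC.
- by rewrite lieC lieZl A2 scalerA mulNr scaleNr opprK mulrC.
Qed.

(** If [c = 0], the line of [b1] splits off. Otherwise [x] is divided by [- c] to normalize the
    eigenvalue, and [b2] by [c] to restore the entry 1 of the Jordan block. *)
Lemma jordan_exceptional x b1 b2 b3 c : x \notin I ->
    basis_of I [:: b1; b2; b3] ->
    [lie x, b1] = c *: b1 -> [lie x, b2] = c *: b2 -> [lie x, b3] = c *: b3 + b2 ->
  exceptional g.
Proof.
move=> xI bI A1 A2 A3.
have c0 : c != 0.
  apply/eqP => c0; apply: g_indec.
  by apply: (direct_summand_decomposable g_dim I_dim I_comm xI bI);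
    rewrite ?A1 ?A2 ?A3 ?c0 ?scale0r ?add0r ?mem0v // memv_span ?mem_head.
have bI' : basis_of I [:: b1; c^-1 *: b2; b3].
  apply: (triple_basis_change I_dim bI) => y; rewrite !inE => /or3P[] /eqP ->.
  - by rewrite memv_span ?mem_head.
  - by apply/memv_span3P; exists 0, c, 0; to_coords; field.
  - by rewrite memv_span // !inE eqxx !orbT.
apply: Or31; split; first exact: oner_neq0.
exists b1, (c^-1 *: b2), b3, (- c^-1 *: x).
split; rewrite ?basis_model ?oppr_eq0 ?invr_eq0 //; first exact: model_comm.
- by rewrite lieC lieZl A1; to_coords; field.
- by rewrite lieC lieZl lieZr A2; to_coords; field.
- by rewrite lieC lieZl A3; to_coords; field.
Qed.

Lemma model_quadratic E1 E2 E3 E4 r s :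
    basis_of fullv [:: E1; E2; E3; E4] ->
    E1 \in I -> E2 \in I -> E3 \in I ->
    (forall v, v \in [:: E1; E2; E3] ->
      [lie E4, [lie E4, v]] = r *: v + s *: [lie E4, v]) ->
  ~ exists p, \dim p = 2%N /\ generating p.
Proof.
move=> bE E1I E2I E3I quad.
have E4I : E4 \notin I.
  apply/negP => E4I; suff /dimvS : (fullv <= I)%VS by rewrite g_dim I_dim.
  rewrite -(span_basis bE); apply/span_subvP => y.
  by rewrite !inE => /or4P[] /eqP ->.
have bI : basis_of I [:: E1; E2; E3].
  have := basis_free bE; rewrite -[[:: _; _; _; _]]/([:: E1; E2; E3] ++ [:: E4]).
  move=> /catl_free fE; rewrite basisEfree fE I_dim andbT /=.
  by apply/span_subvP => y; rewrite !inE => /or3P[] /eqP ->.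
apply: (quadratic_not_generating g_dim I_dim I_ideal I_comm E4I (r := r) (s := s)) => v.
rewrite -{1}(span_basis bI) => /memv_span3P[a [b [c ->]]].
by rewrite !lieE !quad ?inE ?eqxx ?orbT //; to_coords; ring.
Qed.

Lemma exceptional_not_generating : exceptional g ->
  ~ exists p, \dim p = 2%N /\ generating p.
Proof.
have /subvPn[x _ xI] : ~~ (fullv <= I)%VS.
  by apply/negP => /dimvS; rewrite g_dim I_dim.
have derI := lie_derived_sub I_codim I_comm xI (fun i => @I_ideal x i).
(* The models do not mention [I]; their eigenvectors for nonzero eigenvalues lie in the derived
   algebra, hence in [I]. *)
have in_I a y z : a != 0 -> [lie y, z] = a *: y -> y \in I.
  by move=> a0 yE; rewrite -(memvZE _ _ a0) -yE derI.
have quad45 a b : iso_g45 a b g -> b = 1 \/ b = a -> a != 0 ->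
    ~ exists p, \dim p = 2%N /\ generating p.
  move=> [_ [E1 [E2 [E3 [E4 [bE _ A1 A2 A3]]]]]] ab a0.
  have b0 : b != 0 by case: ab => ->; rewrite ?oner_neq0.
  (* [ad E4] has only the eigenvalues -1 and [- a] on [I], hence the relation
     [(t + 1) * (t + a) = 0]. *)
  apply: (model_quadratic (r := - a) (s := - (1 + a)) bE).
  - by apply: (in_I 1 _ E4); rewrite ?oner_neq0 // scale1r.
  - exact: in_I A2.
  - exact: in_I A3.
  have B1 : [lie E4, E1] = (-1) *: E1 by rewrite lieC A1 scaleN1r.
  have B2 : [lie E4, E2] = (- b) *: E2 by rewrite lieC A2 scaleNr.
  have B3 : [lie E4, E3] = (- a) *: E3 by rewrite lieC A3 scaleNr.
  move=> v; rewrite !inE => /or3P[] /eqP ->; rewrite !(B1, B2, B3, lieE).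
  - by to_coords; ring.
  - by case: ab => ->; to_coords; ring.
  - by to_coords; ring.
case=> [[_ [E1 [E2 [E3 [E4 [bE _ A1 A2 A3]]]]]] | [a [_ _ a0 h]] | [a [_ _ a0 h]]].
- have E2I : E2 \in I by apply: (in_I 1 _ E4); rewrite ?oner_neq0 // scale1r.
  (* The coefficients come from [(t + 1)^2 = 0], as -1 is the only eigenvalue and the largest Jordan
     block has size 2. *)
  apply: (model_quadratic (r := -1) (s := -2) bE) => //.
  + by apply: in_I A1; rewrite oner_neq0.
  + by rewrite -[E3](addKr E2) -A3 addrC memvB.
  have B1 : [lie E4, E1] = (-1) *: E1 by rewrite lieC A1 scaleNr.
  have B2 : [lie E4, E2] = (-1) *: E2 by rewrite lieC A2 scaleN1r.
  have B3 : [lie E4, E3] = (-1) *: (E2 + E3) by rewrite lieC A3 scaleN1r.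
  move=> v; rewrite !inE => /or3P[] /eqP ->; rewrite !(B1, B2, B3, lieE);
    by to_coords; ring.
- by apply: quad45 h _ a0; left.
- by apply: quad45 h _ a0; right.
Qed.

Lemma generating_existsP :
  (exists p, \dim p = 2%N /\ generating p) <-> ~ exceptional g.
Proof.
split=> [gen /exceptional_not_generating|nexc]; first exact.
apply: contrapT => ngen; apply: nexc.
have /subvPn[x _ xI] : ~~ (fullv <= I)%VS.
  by apply/negP => /dimvS; rewrite g_dim I_dim.
have noncyc := noncyclic_of_not_generating g_dim I_dim I_ideal I_comm ngen.
have [b1 [b2 [b3 [c [bI A1 A2 A3]]]]] :=
  noncyclic_normal_form I_dim I_ideal x noncyc.
case: A3 => [A3|[d A3]]; first exact: jordan_exceptional bI A1 A2 A3.
exact: diagonal_exceptional bI A1 A2 A3.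
Qed.

End RealClassification.

Theorem proposition3 (R : realType) (g : lieAlgType R) (I : {vspace g})
    (g_dim : \dim {: g} = 4%N) (g_indec : indecomposable g)
    (I_dim : \dim I = 3%N) (I_ideal : lie_ideal I) (I_comm : lie_commutative I) :
  [/\ (exists p : {vspace g}, \dim p = 2%N /\ generating p) <-> ~ exceptional g,
      forall p : {vspace g}, \dim p = 2%N ->
        (generating p <->
         ~ (p <= I)%VS /\
         forall J : {vspace g}, lie_ideal J -> (J <= I)%VS -> J != I ->
           (p :&: J)%VS = 0%VS),
      forall p : {vspace g}, \dim p = 2%N -> generating p ->
        forall e1 e2 : g, basis_of p [:: e1; e2] -> e2 \in (p :&: I)%VS ->
          let e3 := [lie e1, e2] in
          let e4 := [lie e1, e3] in
          let e := [tuple e1; e2; e3; e4] in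
          [/\ basis_of fullv e,
              structure_constant e (inord 1) (inord 2) (inord 3) = 0
            & [lie e2, e3] = 0]
    & forall p q : {vspace g}, \dim p = 2%N -> \dim q = 2%N ->
        generating p -> generating q ->
        exists2 f : 'End(g), lie_automorphism f & (f @: p)%VS = q].
Proof.
have I_codim : \dim {:g} = (\dim I).+1 by rewrite g_dim I_dim.
split.
- exact: (generating_existsP g_dim g_indec I_dim I_ideal I_comm).
- by move=> p p_dim; apply: (generatingP I_codim I_ideal I_comm p_dim).
- move=> p p_dim gp e1 e2 bp /memv_capP[_ e2I] e3 e4 e.
  have [e1I bI] := generating_krylov_basis g_dim I_dim I_ideal I_comm p_dim gp bp e2I.
  have e23 : [lie e2, e3] = 0 by apply: I_comm; rewrite ?I_ideal.
  split=> //; first exact: (basis_cons_outside I_codim bI e1I).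
  (* With indices counted from 0, the constant is the last coordinate of [[lie e2, e3]], which
     vanishes. *)
  rewrite /structure_constant !(tnth_nth 0) !inordK //= -/e3.
  by rewrite e23 linear0.
- by move=> p q; apply: (generating_conjugate g_dim I_dim I_ideal I_comm).
Qed.
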